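(* Let $d\ge1$ and let $\mathbf{C}_i\in\mathbb{R}^{n_i\times n_i}$, $i=1,\dots,d$, be symmetric positive definite (covariance) matrices. Then $$\log\det(\mathbf{C}_1\otimes\cdots\otimes\mathbf{C}_d)=\sum_{j=1}^d\Big(\log\det\mathbf{C}_j\Big)\prod_{i=1,\,i\ne j}^d n_i.$$
   Context: $\otimes$ denotes the Kronecker product of matrices; an empty product equals $1$. *)

(* Defs.v *)
From mathcomp Require Import all_boot all_order all_algebra.
From mathcomp Require Import mxtens.
From mathcomp Require Import reals exp.

Set Implicit Arguments.
Unset Strict Implicit.
Unset Printing Implicit Defensive.

Import Order.TTheory GRing.Theory Num.Theory.
Local Open Scope ring_scope.

Definition spd (R : realType) (n : nat) (A : 'M[R]_n) : Prop :=
  A \is symmetricmx /\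
  forall u : 'cV[R]_n, u != 0 -> 0 < (u^T *m A *m u) 0 0.

(* The Kronecker product (... (C_0 *t C_1) *t ...) *t C_(d-1), starting from
   the 1 x 1 identity matrix; [castmx] only re-types the matrix along
   \prod_(i < d.+1) n i = (\prod_(i < d) n i) * n ord_max.                  *)
Fixpoint kronmx (R : pzRingType) (d : nat) :
    forall n : 'I_d -> nat, (forall i, 'M[R]_(n i)) ->
    'M[R]_(\prod_(i < d) n i) :=
  match d with
  | 0 => fun n C => 1%:M
  | d'.+1 => fun n C =>
      let e := esym (big_ord_recr d' n) in
      castmx (e, e)
        (kronmx (fun i : 'I_d' => C (widen_ord (leqnSn d') i)) *t C ord_max)
  end.

(* Main.v *)
Require Import Defs.
From mathcomp Require Import all_boot all_order all_algebra.
From mathcomp Require Import perm mxtens.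
From mathcomp Require Import reals exp.

(** The identity reduces to the determinant formula
    [det (A *t B) = det A ^ n * det B ^ m] for A of size m and B of size n.
    Writing [A *t B = (A *t 1) *m (1 *t B)], the second factor is block diagonal
    with m copies of B ([det_tens1mx]), and the first one is [1 *t A] up to a
    simultaneous permutation of rows and columns ([det_tensmxC]).  Iterating
    ([det_kronmx]), the determinant of the full product is the product of the
    [det (C j)], each raised to the product of the sizes other than [n j].

    Taking logarithms requires every [det (C j)] to be positive.  This is
    [posdef_det_gt0]: along the segment from A to the identity every matrix is
    positive definite, hence invertible, so its determinant, a polynomial in the
    parameter of the segment, keeps the sign it has at the identity. *)

Import Order.TTheory GRing.Theory Num.Theory.
Local Open Scope ring_scope.

(** * Determinants of Kronecker products *)

Lemma det_castmx (R : comNzRingType) (m n : nat) (e : m = n) (A : 'M[R]_m) :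
  \det (castmx (e, e) A) = \det A.
Proof. by case: _ / e; rewrite castmx_id. Qed.

Lemma det_tens1mx (R : comNzRingType) (m n : nat) (B : 'M[R]_n) :
  \det ((1%:M : 'M[R]_m) *t B) = \det B ^+ m.
Proof.
elim: m => [|m IHm].
  by rewrite expr0; exact: (det_mx00 (_ : 'M[R]_0)).
rewrite (scalar_mx_block 1 m) tens_block_mx tens0mx.
by rewrite det_castmx det_lblock IHm tens_scalar1mx det_castmx exprS.
Qed.

(** The two factors of a Kronecker product are exchanged by the commutation
    permutation of the index set, acting on rows and columns alike, so its sign
    enters the determinant twice. *)
Lemma det_tensmxC (R : comNzRingType) (m n : nat) (A : 'M[R]_m) (B : 'M[R]_n) :
  \det (A *t B) = \det (B *t A).
Proof.
pose swap p q (k : 'I_(p * q)) : 'I_(q * p) :=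
  mxtens_index ((mxtens_unindex k).2, (mxtens_unindex k).1).
have swapK p q : cancel (@swap p q) (@swap q p).
  by move=> k; rewrite /swap mxtens_indexK -surjective_pairing mxtens_unindexK.
pose e : (n * m)%N = (m * n)%N := mulnC n m.
pose f (k : 'I_(m * n)) : 'I_(m * n) := cast_ord e (swap _ _ k).
have f_inj : injective f.
  by move=> k l /cast_ord_inj /(can_inj (swapK _ _)).
pose s := perm f_inj.
have <- : row_perm s (col_perm s (castmx (e, e) (B *t A))) = A *t B.
  apply/matrixP => i j; rewrite !mxE castmxE !permE /f !cast_ordK !mxE.
  by rewrite !mxtens_indexK mulrC.
rewrite row_permE col_permE !det_mulmx !det_perm odd_permV det_castmx.
by rewrite mulrCA -signr_addb addbb mulr1.
Qed.

Lemma det_tensmx (R : comNzRingType) (m n : nat) (A : 'M[R]_m) (B : 'M[R]_n) :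
  \det (A *t B) = \det A ^+ n * \det B ^+ m.
Proof. by rewrite tensmx_decr det_mulmx det_tensmxC !det_tens1mx. Qed.

(** Appending a last factor of size k raises the determinant of the previous
    product to the power k, which is the factor that each earlier exponent
    gains; the last determinant itself gets as exponent the size of that
    previous product. *)
Lemma det_kronmx (R : comNzRingType) (d : nat) (n : 'I_d -> nat)
    (C : forall i : 'I_d, 'M[R]_(n i)) :
  \det (kronmx C) = \prod_(j < d) \det (C j) ^+ (\prod_(i < d | i != j) n i).
Proof.
elim: d n C => [|d IHd] n C; first by rewrite [RHS]big_ord0; exact: det1.
have wE (i : 'I_d) : widen_ord (leqnSn d) i != ord_max.
  by rewrite -val_eqE /= ltn_eqF.
rewrite /= det_castmx det_tensmx IHd -prodrXl big_ord_recr /=.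
congr (_ * _); last first.
  congr (_ ^+ _); rewrite [RHS]big_mkcond big_ord_recr /= eqxx muln1.
  by apply: eq_bigr => i _; rewrite wE.
apply: eq_bigr => j _; rewrite -exprM; congr (_ ^+ _).
rewrite [RHS]big_mkcond big_ord_recr /= eq_sym wE; congr (_ * _)%N.
by rewrite big_mkcond.
Qed.

(** * Positivity of the determinants *)

Lemma tr_mul_gt0 (R : realDomainType) (n : nat) (u : 'cV[R]_n) :
  u != 0 -> 0 < (u^T *m u) 0 0.
Proof.
move=> u_neq0; have uE : (u^T *m u) 0 0 = \sum_i u i 0 ^+ 2.
  by rewrite mxE; apply: eq_bigr => i _; rewrite mxE expr2.
rewrite uE lt_def sumr_ge0 ?andbT => [|i _]; last exact: sqr_ge0.
apply: contra u_neq0; rewrite psumr_eq0 => [/allP u0|i _]; last exact: sqr_ge0.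
apply/eqP/colP => i; apply/eqP; rewrite mxE -sqrf_eq0.
by apply: u0; rewrite mem_index_enum.
Qed.

(** Were [det A <= 0], the polynomial [det ((1 - x) A + x 1)], which is [det A]
    at 0 and 1 at 1, would vanish somewhere on the segment; but a convex
    combination of A and 1 is positive definite, hence has no kernel. *)
Lemma posdef_det_gt0 (R : rcfType) (n : nat) (A : 'M[R]_n) :
  (forall u : 'cV[R]_n, u != 0 -> 0 < (u^T *m A *m u) 0 0) -> 0 < \det A.
Proof.
move=> A_pos; rewrite ltNge; apply/negP => detA_le0.
pose P : 'M[{poly R}]_n :=
  (1 - 'X) *: map_mx (polyC : R -> {poly R}) A + 'X *: 1%:M.
have PE x : (\det P).[x] = \det ((1 - x) *: A + x *: 1%:M).
  rewrite -horner_evalE -det_map_mx; congr (\det _).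
  apply/matrixP => i j; rewrite !mxE /= horner_evalE !hornerE.
  by case: (i == j); rewrite !hornerE.
have P0 : (\det P).[0] = \det A by rewrite PE subr0 scale1r scale0r addr0.
have P1 : (\det P).[1] = 1 by rewrite PE subrr scale0r add0r scale1r det1.
have [|x /andP[x_ge0 x_le1]] := poly_ivt (p := \det P) (a := 0) (b := 1) ler01.
  by rewrite P0 P1 detA_le0 ler01.
rewrite /root PE => /det0P[v v_neq0 vM0].
have u_neq0 : v^T != 0 by rewrite trmx_eq0.
have /matrixP/(_ 0 0) := congr1 (mulmx^~ v^T) vM0.
rewrite mul0mx mulmxDr -!scalemxAr mulmx1 mulmxDl -!scalemxAl !mxE.
apply/eqP; rewrite gt_eqF //.
have := A_pos _ u_neq0; have := tr_mul_gt0 _ _ _ u_neq0; rewrite trmxK !mxE.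
move=> I_gt0 vAv_gt0; have [->|x_neq1] := eqVneq x 1.
  by rewrite subrr mul0r add0r mul1r.
apply: ltr_wpDr; first by rewrite mulr_ge0 // ltW.
by rewrite mulr_gt0 // subr_gt0 lt_neqAle x_neq1.
Qed.

(** * Logarithms *)

Lemma ln_prod (R : realType) (I : Type) (r : seq I) (P : pred I) (F : I -> R) :
  (forall i, P i -> 0 < F i) ->
  ln (\prod_(i <- r | P i) F i) = \sum_(i <- r | P i) ln (F i).
Proof.
move=> F_gt0.
suff [] : 0 < \prod_(i <- r | P i) F i /\
    ln (\prod_(i <- r | P i) F i) = \sum_(i <- r | P i) ln (F i) by [].
elim/big_rec2: _ => [|i y x Pi [x_gt0 <-]]; first by rewrite ln1.
by rewrite mulr_gt0 ?lnM ?F_gt0 // posrE ?F_gt0.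
Qed.

Theorem lemma4p11 (R : realType) (d : nat) (hd : (1 <= d)%N)
    (n : 'I_d -> nat) (C : forall i : 'I_d, 'M[R]_(n i))
    (hC : forall i : 'I_d, spd (C i)) :
  ln (\det (kronmx C)) =
  \sum_(j < d) ln (\det (C j)) * (\prod_(i < d | i != j) n i)%:R.
Proof.
have detC_gt0 j : 0 < \det (C j) by case: (hC j) => _ /posdef_det_gt0.
rewrite det_kronmx ln_prod => [|j _]; last exact: exprn_gt0.
by apply: eq_bigr => j _; rewrite lnXn // mulr_natr.
Qed.
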